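(* Let $A,B\in\mathrm{SL}_2\mathbb{Z}_{\ge0}$ be noncommuting and such that the pair $A,B$ is well oriented, and assume $\mathrm{tr}(A)<\mathrm{tr}(B)$ and $\mathrm{tr}(AB)<\mathrm{tr}(B^2)$. Then $b$ is the only optimal word.
   Context: $\mathrm{SL}_2\mathbb{Z}_{\ge0}$ denotes the $2\times2$ matrices with nonnegative integer entries and determinant $1$. Fixed points are taken for the Möbius action on $\partial\mathcal{H}=\mathbb{P}^1\mathbb{R}$; $\alpha^\pm$ ($\beta^\pm$) are the attracting/repelling fixed points of $A$ ($B$), equal to the unique fixed point if parabolic. With $\partial\mathcal{H}$ cyclically ordered and $[\alpha,\beta]$ the closed counterclockwise interval from $\alpha$ to $\beta$, let $I^+=\{\alpha^+\}$ if $\alpha^+=\beta^+$, and otherwise the one of $[\alpha^+,\beta^+],[\beta^+,\alpha^+]$ mapped into itself by both $A$ and $B$ (if it exists); define $I^-$ likewise with $A^{-1},B^{-1},\alpha^-,\beta^-$. The pair is coherently oriented if both exist, and well oriented if $A,B$ is coherently oriented but $A,B^{-1}$ is not. Words: $F_2^+$ is the free semigroup of nonempty words over $\{a,b\}$, $|w|$ the length, $\phi(a)=A,\phi(b)=B$, $[w]=\mathrm{tr}(\phi(w))$. Define $w\preceq u$ iff $[w^{|u|}]\le[u^{|w|}]$; $w$ is maximal if $u\preceq w$ for all $u$. A Lyndon word is one strictly smaller lexicographically ($a<b$) than each of its proper rotations. A complete set of optimal words is a set of pairwise distinct maximal Lyndon words such that every maximal word is a power of a rotation of one of them; it is unique if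 it exists, and its elements are the optimal words. *)

(* Defs.v *)
From HB Require Import structures.
From mathcomp Require Import all_boot all_order all_algebra.
From mathcomp Require Import reals.
Set Implicit Arguments.
Unset Strict Implicit.
Unset Printing Implicit Defensive.
Import Order.TTheory GRing.Theory Num.Theory.
Local Open Scope ring_scope.

Definition SL2Znn (M : 'M[int]_2) : Prop :=
  (forall i j, 0 <= M i j) /\ \det M = 1.

Section Projective.
Variable R : realFieldType.

(* Points of the boundary P^1(R) = R u {oo}: [Some x] is x, [None] is oo. *)
Definition vec (p : option R) : 'cV[R]_2 :=
  \col_(i < 2) match p with
               | Some x => if i == ord0 then x else 1
               | None => if i == ord0 then 1 else 0
               end.

Definition mob (M : 'M[R]_2) (p : option R) : option R :=
  let w := M *m vec p in
  if w ord_max ord0 == 0 then None else Some (w ord0 ord0 / w ord_max ord0).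

(* Linear order on R u {oo} with oo on top; going up and wrapping from oo
   to -oo is the counterclockwise orientation of the boundary circle. *)
Definition ple (p q : option R) : bool :=
  match p, q with
  | _, None => true
  | None, Some _ => false
  | Some x, Some y => x <= y
  end.

(* z lies in the closed counterclockwise interval [p, q]. *)
Definition in_arc (p q z : option R) : bool :=
  if ple p q then ple p z && ple z q else ple p z || ple z q.

(* Attracting / repelling fixed points (for matrices with positive
   eigenvalues, e.g. det 1 and trace >= 2): the projective class of an
   eigenvector whose eigenvalue is >= 1 (resp. in (0,1]).  In the parabolic
   case both give the unique fixed point. *)
Definition attracting (M : 'M[R]_2) (p : option R) : Prop :=
  exists l : R, 1 <= l /\ M *m vec p = l *: vec p.
Definition repelling (M : 'M[R]_2) (p : option R) : Prop :=
  exists l : R, 0 < l <= 1 /\ M *m vec p = l *: vec p.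

Definition maps_into (M : 'M[R]_2) (p q : option R) : Prop :=
  forall z, in_arc p q z -> in_arc p q (mob M z).

Definition interval_exists (M N : 'M[R]_2) (p q : option R) : Prop :=
  p = q \/ (maps_into M p q /\ maps_into N p q)
        \/ (maps_into M q p /\ maps_into N q p).

Definition coherently_oriented (A B : 'M[R]_2) : Prop :=
  exists ap bp am bm : option R,
    attracting A ap /\ attracting B bp /\ repelling A am /\ repelling B bm /\
    interval_exists A B ap bp /\ interval_exists (invmx A) (invmx B) am bm.

Definition well_oriented (A B : 'M[R]_2) : Prop :=
  coherently_oriented A B /\ ~ coherently_oriented A (invmx B).

End Projective.

(* Words over {a,b}: a = false, b = true (so a < b). *)
Definition word := seq bool.

Definition phi (A B : 'M[int]_2) (w : word) : 'M[int]_2 :=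
  foldr (fun x M => (if x then B else A) *m M) 1%:M w.

Definition wtr (A B : 'M[int]_2) (w : word) : int := \tr (phi A B w).

Definition wpow (w : word) (n : nat) : word := flatten (nseq n w).

Definition wle (A B : 'M[int]_2) (w u : word) : bool :=
  wtr A B (wpow w (size u)) <= wtr A B (wpow u (size w)).

Definition maximal (A B : 'M[int]_2) (w : word) : Prop :=
  (0 < size w)%N /\ forall u : word, (0 < size u)%N -> wle A B u w.

Fixpoint lex_lt (u v : word) : bool :=
  match u, v with
  | [::], [::] => false
  | [::], _ :: _ => true
  | _ :: _, [::] => false
  | x :: u', y :: v' => (~~ x && y) || ((x == y) && lex_lt u' v')
  end.

Definition lyndon (w : word) : Prop :=
  (0 < size w)%N /\ forall k, (0 < k < size w)%N -> lex_lt w (rot k w).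

(* S is a complete set of optimal words (a set of words = a predicate;
   distinctness is automatic). *)
Definition complete_optimal (A B : 'M[int]_2) (S : word -> Prop) : Prop :=
  (forall w, S w -> lyndon w /\ maximal A B w) /\
  (forall w, maximal A B w ->
     exists (u : word) (k n : nat), S u /\ w = wpow (rot k u) n).

(* Main.v *)
(** Let [lam > 1] be the Perron eigenvalue of [B] and [f > 0] a left
    eigenvector for it.  Since traces are integers, [tr (A B) <= (tr B)^2 - 3],
    which is exactly enough to find [mu < lam] with [mu >= tr A] such that, for
    [l = mu f - f A], the cone [{x >= 0 | l x >= 0}] is invariant under both [A]
    and [B]: by Cayley-Hamilton, [l A] is nonnegative and [l B] is [l / lam] plus
    a nonnegative multiple of [f].  On this cone [A] multiplies [f] by at most
    [mu] and [B] by exactly [lam], so a product of length [n] containing [A] has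
    spectral radius less than [lam ^ n], hence trace less than [tr (B ^ n)]. *)
Require Import Defs.
From HB Require Import structures.
From mathcomp Require Import all_boot all_order all_algebra.
From mathcomp Require Import reals.
From mathcomp Require Import zify ring lra.
Set Implicit Arguments.
Unset Strict Implicit.
Unset Printing Implicit Defensive.
Import Order.TTheory GRing.Theory Num.Theory.
Local Open Scope ring_scope.

(** * Identities for two-by-two matrices *)

Section TwoByTwo.
Variable R : comNzRingType.

Lemma ord2P (P : 'I_2 -> Prop) : P 0 -> P 1 -> forall i, P i.
Proof.
by move=> P0 P1 [[|[|//]] lti]; [move: P0 | move: P1];
  congr P; apply: val_inj.
Qed.

Lemma mulmx2E m n (M : 'M[R]_(m, 2)) (N : 'M_(2, n)) i j :
  (M *m N) i j = M i 0 * N 0 j + M i 1 * N 1 j.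
Proof.
rewrite mxE big_ord_recl big_ord_recl big_ord0 addr0.
by congr (_ + M i _ * N _ j); apply: val_inj.
Qed.

Lemma mxtrace2E (M : 'M[R]_2) : \tr M = M 0 0 + M 1 1.
Proof.
rewrite /mxtrace big_ord_recl big_ord_recl big_ord0 addr0.
by congr (_ + M _ _); apply: val_inj.
Qed.

Lemma det2E (M : 'M[R]_2) : \det M = M 0 0 * M 1 1 - M 0 1 * M 1 0.
Proof.
rewrite (expand_det_row _ 0) big_ord_recl big_ord_recl big_ord0 addr0.
rewrite /cofactor !det_mx11 !mxE /= expr0 expr1 mul1r mulN1r mulrN.
by congr (M 0 0 * M _ _ - M 0 _ * M _ _); apply: val_inj.
Qed.

Lemma det2_subscalar (M : 'M[R]_2) L :
  \det (L%:M - M) = L ^+ 2 - \tr M * L + \det M.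
Proof. by rewrite !det2E mxtrace2E !mxE /=; ring. Qed.

Lemma sqrmx_det1 (M : 'M[R]_2) : \det M = 1 -> M *m M = \tr M *: M - 1%:M.
Proof.
rewrite det2E mxtrace2E => detM; apply/matrixP.
by apply: ord2P; apply: ord2P; rewrite mulmx2E !mxE /= -detM; ring.
Qed.

End TwoByTwo.

(** Cayley-Hamilton for [A *m B], multiplied on the left by the inverse of [A], which is
    [(\tr A)%:M - A]. *)
Lemma mulmx_det1_sandwich (R : comUnitRingType) (A B : 'M[R]_2) :
  \det A = 1 -> \det B = 1 ->
  B *m A *m B = \tr (A *m B) *: B + A - (\tr A)%:M.
Proof.
move=> detA detB; have Au : A \in unitmx by rewrite unitmxE detA unitr1.
apply: (can_inj (mulKmx Au)); have := @sqrmx_det1 _ (A *m B).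
rewrite det_mulmx detA detB mulr1 => /(_ erefl).
rewrite !mulmxA mulmxBr mulmxDr sqrmx_det1 // mul_mx_scalar -scalemxAr => ->.
by rewrite addrA addrAC addrK.
Qed.

(** * Nonnegative matrices and invariant plane cones *)

Definition nonneg (R : numDomainType) m n (M : 'M[R]_(m, n)) : Prop :=
  forall i j, 0 <= M i j.

Lemma nonneg_mul2 (R : numDomainType) m n (M : 'M[R]_(m, 2)) (N : 'M_(2, n)) :
  nonneg M -> nonneg N -> nonneg (M *m N).
Proof. by move=> M0 N0 i j; rewrite mulmx2E addr_ge0 ?mulr_ge0. Qed.

Section Cone.
Variable R : realFieldType.

Definition cone (l : 'rV[R]_2) (x : 'cV[R]_2) : Prop :=
  nonneg x /\ 0 <= (l *m x) 0 0.

(** The cone is spanned by [e = (1, 0)] and [v = (- l1, l0)], where [l] vanishes on [v]. Under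
    [L - M] they go to [(P, - m10)] and [(Q, S)], so [P * S + m10 * Q] is the determinant of [L - M]
    times that of the pair [e], [v], which is [l0]. *)
Lemma det2_gt0_of_wedge (f0 f1 l0 l1 m00 m01 m10 m11 L : R) :
  0 < f0 -> 0 < f1 -> 0 < l0 -> l1 < 0 -> 0 <= m10 ->
  f0 * m00 + f1 * m10 < L * f0 ->
  f0 * (- l1 * m00 + l0 * m01) + f1 * (- l1 * m10 + l0 * m11)
    < L * (f0 * - l1 + f1 * l0) ->
  0 <= l0 * (- l1 * m00 + l0 * m01) + l1 * (- l1 * m10 + l0 * m11) ->
  0 < (L - m00) * (L - m11) - m01 * m10.
Proof.
move=> f0P f1P l0P l1N m10P H1 H2 H3.
pose P := L - m00; pose Q := - L * l1 + l1 * m00 - l0 * m01.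
pose S := L * l0 + l1 * m10 - l0 * m11.
have detE : ((L - m00) * (L - m11) - m01 * m10) * l0 = P * S + m10 * Q.
  by rewrite /P /Q /S; ring.
rewrite -(pmulr_lgt0 _ l0P) detE.
have h1 : 0 < f0 * P - f1 * m10 by rewrite /P; lra.
have h2 : 0 < f0 * Q + f1 * S by rewrite /Q /S; lra.
have h3 : l0 * Q + l1 * S <= 0 by rewrite /Q /S; lra.
have SP : 0 < S.
  rewrite ltNge; apply/negP => Sle.
  have : 0 <= l1 * S by rewrite mulr_le0 // ltW.
  have : f1 * S <= 0 by rewrite mulr_ge0_le0 // ltW.
  move=> a b; have : 0 < f0 * Q by lra.
  by rewrite pmulr_rgt0 // => /(mulr_gt0 l0P); lra.
(* [f0 * (P * S + m10 * Q) = (f0 * P - f1 * m10) * S + m10 * (f0 * Q + f1 * S)]. *)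
rewrite -(pmulr_rgt0 _ f0P).
have := mulr_gt0 h1 SP; have := mulr_ge0 m10P (ltW h2); lra.
Qed.

(* The cone is spanned by two vectors of the quadrant, so [M] is a nonnegative
   matrix in a basis where [f] is positive: its Perron root is below [L]. *)
Lemma det_scalar_sub_gt0 (f l : 'rV[R]_2) (M : 'M[R]_2) L :
  (forall j, 0 < f 0 j) -> (l 0 0 < 0 -> 0 < l 0 1) -> (l 0 1 < 0 -> 0 < l 0 0) ->
  nonneg M -> (forall x, cone l x -> cone l (M *m x)) ->
  (forall x, cone l x -> 0 < (f *m x) 0 0 ->
     (f *m (M *m x)) 0 0 < L * (f *m x) 0 0) ->
  0 < \det (L%:M - M).
Proof.
move=> fP l0N l1N M0 Mcone Mlt.
have f0P := fP 0; have f1P := fP 1.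
pose v (a b : R) : 'cV_2 := \col_i (if i == 0 then a else b).
have ve (g : 'rV_2) a b : (g *m v a b) 0 0 = g 0 0 * a + g 0 1 * b.
  by rewrite mulmx2E !mxE.
have Mve (g : 'rV_2) a b : (g *m (M *m v a b)) 0 0 =
    g 0 0 * (M 0 0 * a + M 0 1 * b) + g 0 1 * (M 1 0 * a + M 1 1 * b).
  by rewrite mulmx2E !mulmx2E !mxE.
have vc a b : 0 <= a -> 0 <= b -> 0 <= l 0 0 * a + l 0 1 * b -> cone l (v a b).
  move=> a0 b0 lab; split; last by rewrite ve.
  by apply: ord2P => j; rewrite mxE.
have vlt a b : 0 <= a -> 0 <= b -> 0 <= l 0 0 * a + l 0 1 * b -> 0 < a + b ->
    f 0 0 * (M 0 0 * a + M 0 1 * b) + f 0 1 * (M 1 0 * a + M 1 1 * b) <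
    L * (f 0 0 * a + f 0 1 * b).
  move=> a0 b0 lab ab; rewrite -Mve -ve; apply: Mlt; first exact: vc.
  rewrite ve; have [b_gt0|b_le0] := ltP 0 b.
    by rewrite ltr_wpDl ?mulr_gt0 // mulr_ge0 // ltW.
  by rewrite ltr_wpDr ?mulr_gt0 ?mulr_ge0 // 1?ltW //; lra.
have vl a b : 0 <= a -> 0 <= b -> 0 <= l 0 0 * a + l 0 1 * b ->
    0 <= l 0 0 * (M 0 0 * a + M 0 1 * b) + l 0 1 * (M 1 0 * a + M 1 1 * b).
  by move=> a0 b0 lab; rewrite -Mve; case: (Mcone _ (vc a b a0 b0 lab)).
rewrite det2E !mxE /= !mulr1n !mulr0n !sub0r mulrNN.
have [l0 | l0] := ltP (l 0 0) 0.
  have l1 := l0N l0.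
  have := vlt 0 1 (lexx _) ler01; have := vlt (l 0 1) (- l 0 0).
  have := vl (l 0 1) (- l 0 0).
  move=> vl1 vlt1 vlt0.
  (* The determinant is symmetric in the two coordinates; exchanging them reduces to the situation
     of the wedge lemma. *)
  rewrite mulrC [M 0 1 * _]mulrC.
  apply: (@det2_gt0_of_wedge (f 0 1) (f 0 0) (l 0 1) (l 0 0)) => //; first 1 last.
  - by have := vlt1 _ _ _ _; lra.
  - by have := vl1 _ _ _; lra.
  - by have := vlt0 _ _; lra.
have [l1 | l1] := ltP (l 0 1) 0.
  have {}l0 := l1N l1.
  have := vlt 1 0 ler01 (lexx _); have := vlt (- l 0 1) (l 0 0).
  have := vl (- l 0 1) (l 0 0).
  move=> vl1 vlt1 vlt0.
  apply: (@det2_gt0_of_wedge (f 0 0) (f 0 1) (l 0 0) (l 0 1)) => //; first 1 last.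
  - by have := vlt1 _ _ _ _; lra.
  - by have := vl1 _ _ _; lra.
  - by have := vlt0 _ _; lra.
(* Now [l] is nonnegative and the cone is the whole quadrant: the bounds on the two basis vectors
   are multiplied, and [f 0 0 * f 0 1] is cancelled. *)
have h0 : M 1 0 * f 0 1 < (L - M 0 0) * f 0 0.
  by have := vlt 1 0 ler01 (lexx _); lra.
have h1 : M 0 1 * f 0 0 < (L - M 1 1) * f 0 1.
  by have := vlt 0 1 (lexx _) ler01; lra.
have := ltr_pM _ _ h0 h1; rewrite !mulr_ge0 // 1?ltW // => /(_ isT isT).
rewrite -subr_gt0 => h; rewrite -(pmulr_lgt0 _ (mulr_gt0 f0P f1P)).
by apply: lt_le_trans h _; lra.
Qed.

End Cone.

(** * Growth of products along words *)

Section Words.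
Variables (R : realFieldType) (A B : 'M[int]_2) (f l : 'rV[R]_2) (lam mu : R).
Let toR : int -> R := intr.
Hypotheses (lam_ge0 : 0 <= lam) (mu_ge0 : 0 <= mu).
Hypotheses (coneA : forall x, cone l x -> cone l (map_mx toR A *m x))
           (coneB : forall x, cone l x -> cone l (map_mx toR B *m x)).
Hypotheses (fA : forall x, cone l x ->
              (f *m (map_mx toR A *m x)) 0 0 <= mu * (f *m x) 0 0)
           (fB : forall x, cone l x ->
              (f *m (map_mx toR B *m x)) 0 0 <= lam * (f *m x) 0 0).

(** The one-letter bounds hold only on the cone, so the induction carries invariance along with
    growth. *)
Lemma cone_phi w x : cone l x ->
  cone l (map_mx toR (phi A B w) *m x) /\
  (f *m (map_mx toR (phi A B w) *m x)) 0 0 <=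
    mu ^+ count_mem false w * lam ^+ count_mem true w * (f *m x) 0 0.
Proof.
move=> Cx; elim: w => [|c w [Cw IHw]] /=.
  by rewrite map_mx1 mul1mx !expr0 !mul1r.
rewrite map_mxM -mulmxA; case: c => /=.
- rewrite add0n add1n exprS; split; first exact: coneB.
  by apply: le_trans (fB Cw) _; rewrite mulrCA -mulrA ler_wpM2l.
- rewrite add0n add1n exprS; split; first exact: coneA.
  by apply: le_trans (fA Cw) _; rewrite -!mulrA ler_wpM2l // mulrA.
Qed.

End Words.

Lemma count_bool (w : word) :
  (count_mem false w + count_mem true w)%N = size w.
Proof.
rewrite -(count_predC (pred1 false) w); congr (_ + _)%N.
by apply: eq_count => -[].
Qed.

Lemma phi_nseq_true (A B : 'M[int]_2) n (R : comNzRingType) (f : 'rV[R]_2) (lam : R) :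
  f *m map_mx intr B = lam *: f ->
  f *m map_mx intr (phi A B (nseq n true)) = lam ^+ n *: f.
Proof.
move=> fB; elim: n => [|n IHn] /=; first by rewrite map_mx1 mulmx1 scale1r.
by rewrite map_mxM mulmxA fB -scalemxAl IHn scalerA exprS.
Qed.

Lemma det_phi (A B : 'M[int]_2) w :
  \det A = 1 -> \det B = 1 -> \det (phi A B w) = 1.
Proof.
move=> detA detB; elim: w => [|c w IHw] /=; first exact: det1.
by rewrite det_mulmx IHw mulr1; case: c.
Qed.

Lemma nonneg_phi (A B : 'M[int]_2) w :
  nonneg A -> nonneg B -> nonneg (phi A B w).
Proof.
move=> A0 B0; elim: w => [|c w IHw] /=; last by case: c; apply: nonneg_mul2.
by move=> i j; rewrite mxE; case: eqP.
Qed.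

Lemma wpow_true n : wpow [:: true] n = nseq n true.
Proof. by elim: n => [|n IHn] //=; rewrite -IHn. Qed.

(** * Positivity of entries and Perron eigenvectors *)

(** A zero on the diagonal would make the determinant nonpositive. *)
Lemma SL2Znn_diag (A : 'M[int]_2) : SL2Znn A -> 1 <= A 0 0 /\ 1 <= A 1 1.
Proof.
case=> A0; rewrite det2E => detA.
have bc := mulr_ge0 (A0 0 1) (A0 1 0).
by split; rewrite -gtz0_ge1 lt0r A0 andbT; apply/eqP => a0;
  move: detA bc; rewrite a0 ?mul0r ?mulr0; lra.
Qed.

(** Diagonal entries at least 1 with sum above 2 have product above 1, so the off-diagonal product
    is positive. *)
Lemma SL2Znn_offdiag (A : 'M[int]_2) : SL2Znn A -> 2 < \tr A ->
  0 < A 0 1 /\ 0 < A 1 0.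
Proof.
move=> SA; have [a1 d1] := SL2Znn_diag SA; case: SA => A0.
rewrite det2E mxtrace2E => detA trA.
have ad : 1 < A 0 0 * A 1 1 by move: (A 0 0) (A 1 1) a1 d1 trA => a d; nia.
by split; rewrite lt0r A0 andbT; apply/eqP => b0;
  move: detA ad; rewrite b0 ?mul0r ?mulr0; lra.
Qed.

Lemma left_perron (R : realFieldType) (B : 'M[R]_2) (lam : R) :
  (forall i j, 0 < B i j) -> \det B = 1 -> 1 < lam -> lam + lam^-1 = \tr B ->
  exists2 f : 'rV[R]_2, forall j, 0 < f 0 j & f *m B = lam *: f.
Proof.
move=> B_gt0 detB lam1 lamB; have lam0 : lam != 0 by lra.
have charB : lam * lam + 1 = \tr B * lam.
  by rewrite -lamB mulrDl mulVf.
move: charB detB; rewrite mxtrace2E det2E.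
have := B_gt0 0 0; have := B_gt0 0 1; have := B_gt0 1 0; have := B_gt0 1 1.
move=> b11 b10 b01 b00 charB detB.
(* The factors [lam - B 0 0] and [lam - B 1 1] have positive product, and their sum [lam - lam^-1]
   is positive. *)
have b0 : B 0 0 < lam.
  have : 0 < (lam - B 0 0) * (lam - B 1 1) by have := mulr_gt0 b01 b10; lra.
  have : lam^-1 < 1 by rewrite invf_lt1 //; lra.
  rewrite mxtrace2E in lamB; nra.
(* This row satisfies the first column of the eigenvector equation identically; the second column is
   the characteristic equation. *)
exists (\row_j (if j == 0 then B 1 0 else lam - B 0 0)).
  by apply: ord2P; rewrite mxE //= subr_gt0.
apply/matrixP => i; apply: ord2P; rewrite ord1 mulmx2E !mxE /=; first by ring.
by lra.
Qed.

(** [lam] is the larger root of [t ^+ 2 - y * t + 1]; real closedness supplies the square root of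
    the discriminant. *)
Lemma perron_root (R : rcfType) (y : R) : 2 < y ->
  exists2 lam : R, 1 < lam & lam + lam^-1 = y.
Proof.
move=> y2; pose s := Num.sqrt (y ^+ 2 - 4).
have s2 : s ^+ 2 = y ^+ 2 - 4 by rewrite sqr_sqrtr //; nra.
have s0 : 0 <= s by exact: sqrtr_ge0.
have lam1 : 1 < (y + s) / 2 by lra.
exists ((y + s) / 2) => //.
have lam0 : (y + s) / 2 != 0 by lra.
apply: (mulIf lam0); rewrite mulrDl mulVf //.
by have := s2; rewrite !expr2; lra.
Qed.

(** * Trace comparison with powers of [B] *)

Lemma wtr_lt_power_true (R : rcfType) (A B : 'M[int]_2) (w : word) :
  SL2Znn A -> SL2Znn B -> \tr A < \tr B -> \tr (A *m B) < \tr (B *m B) ->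
  false \in w -> wtr A B w < wtr A B (nseq (size w) true).
Proof.
move=> SA SB trAB trABB wa.
have [detA detB] := (SA.2, SB.2).
have trA2 : 2 <= \tr A.
  by have [? ?] := SL2Znn_diag SA; rewrite mxtrace2E; lra.
have trBB : \tr (B *m B) = \tr B * \tr B - 2.
  by rewrite sqrmx_det1 // raddfB /= mxtraceZ mxtrace1.
have trB3 : 2 < \tr B by lra.
pose x : R := (\tr A)%:~R; pose y : R := (\tr B)%:~R.
pose z : R := (\tr (A *m B))%:~R.
have x2 : 2 <= x by rewrite /x -[2]/(2%:~R) ler_int.
have xy : x <= y - 1 by rewrite /x /y -[1]/(1%:~R) -intrB ler_int; lia.
(* Integrality sharpens [z < y * y - 2] by one. *)
have zy : z <= y * y - 3.
  by rewrite /z /y -[3]/(3%:~R) -intrM -intrB ler_int; lia.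
have [lam lam1 lamy] : exists2 lam : R, 1 < lam & lam + lam^-1 = y.
  by apply: perron_root; lra.
pose toR : int -> R := intr.
pose Ar := map_mx toR A; pose Br := map_mx toR B.
have Ar_ge0 : nonneg Ar by move=> i j; rewrite mxE ler0z; apply: SA.1.
have detAr : \det Ar = 1 by rewrite det_map_mx detA.
have detBr : \det Br = 1 by rewrite det_map_mx detB.
have trAr : \tr Ar = x by rewrite trace_map_mx.
have trABr : \tr (Ar *m Br) = z by rewrite -map_mxM trace_map_mx.
have [[b00 b11] [b01 b10]] := (SL2Znn_diag SB, SL2Znn_offdiag SB trB3).
have Br_gt0 i j : 0 < Br i j.
  rewrite mxE ltr0z; move: i j.
  by apply: ord2P; apply: ord2P => //; rewrite -gtz0_ge1.
have Br_ge1 i : 1 <= Br i i.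
  by rewrite mxE -[1]/(1%:~R) ler_int; move: i; apply: ord2P.
have [|f f_gt0 fB] := left_perron Br_gt0 detBr lam1.
  by rewrite lamy trace_map_mx.
pose i := lam^-1.
have i0 : 0 < i by rewrite invr_gt0; lra.
have i1 : i < 1 by rewrite invf_lt1 //; lra.
have lam_gt0 : 0 < lam by lra.
have lam0 : lam != 0 by rewrite gt_eqF.
have lami : lam * i = 1 by rewrite mulfV.
rewrite -/i in lamy.
(* The least [mu] for which the coefficients [mu - x] in [lA] and [mu * (lam - i) - (z - x * i)] in
   [lB] are both nonnegative. *)
pose mu := Num.max x ((z - x * i) / (lam - i)).
have mux : x <= mu by rewrite le_max lexx.
have mut : z - x * i <= mu * (lam - i).
  by rewrite -ler_pdivrMr ?le_max ?lexx ?orbT //; lra.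
(* For the second term of the maximum, [y = lam + i] gives [z <= lam ^+ 2 - 1 + i ^+ 2], and
   [i ^+ 2 < x * i] then yields [z - x * i < lam * (lam - i)]. *)
have mulam : mu < lam.
  rewrite gt_max ltr_pdivrMr; last by lra.
  apply/andP; split; first by move: xy; rewrite -lamy; lra.
  have ii : i * i < i by rewrite -[ltRHS]mulr1 ltr_pM2l.
  by have := ler_wpM2r (ltW i0) x2; move: zy; rewrite -lamy; lra.
have fA_ge0 : nonneg (f *m Ar).
  by apply: nonneg_mul2 => // ? j; rewrite ord1 ltW.
pose l := mu *: f - f *m Ar.
have lA : l *m Ar = (mu - x) *: (f *m Ar) + f.
  rewrite mulmxBl -mulmxA sqrmx_det1 // trAr mulmxBr mulmx1 -scalemxAl -scalemxAr.
  by rewrite opprB addrCA addrC scalerBl.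
(* Since [lam *: f = f *m Br], scaling by [lam] turns the left side into [f *m (Br *m Ar *m Br)],
   where the sandwich identity applies. *)
have fAB : f *m Ar *m Br = (z - x * i) *: f + i *: (f *m Ar).
  apply: (scalerI lam0); rewrite 2!scalemxAl -fB -!mulmxA (mulmxA Br).
  rewrite mulmx_det1_sandwich // trABr trAr mulmxBr mulmxDr mul_mx_scalar.
  rewrite -scalemxAr fB scalerDr !scalerA lami scale1r.
  by rewrite mulrBr mulrCA lami mulr1 scalerBl (mulrC lam z) addrAC.
have lB : l *m Br = i *: l + (mu * (lam - i) - (z - x * i)) *: f.
  rewrite mulmxBl -scalemxAl fB fAB scalerA scalerBr scalerA.
  apply/rowP => j; rewrite !mxE; ring.
have coneA v : cone l v -> cone l (Ar *m v).
  case=> v0 lv; split; first exact: nonneg_mul2.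
  rewrite mulmxA lA; apply: nonneg_mul2 => // i' j.
  rewrite [i']ord1 mxE [X in X + _]mxE addr_ge0 //; last exact: ltW.
  by rewrite mulr_ge0 ?subr_ge0 //; apply: fA_ge0.
have coneB v : cone l v -> cone l (Br *m v).
  case=> v0 lv; split; first by apply: nonneg_mul2 => // ? ?; apply: ltW.
  rewrite mulmxA lB mulmxDl -!scalemxAl mxE [X in X + _]mxE [X in _ + X]mxE.
  rewrite addr_ge0 // mulr_ge0 ?subr_ge0 //; first exact: ltW.
  by apply: nonneg_mul2 => // ? ?; rewrite ord1 ltW.
have fAmu v : cone l v -> (f *m (Ar *m v)) 0 0 <= mu * (f *m v) 0 0.
  case=> _; rewrite mulmxBl -scalemxAl mulmxA.
  by rewrite mxE [X in X + _]mxE [X in _ + X]mxE subr_ge0.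
have fBlam v : cone l v -> (f *m (Br *m v)) 0 0 <= lam * (f *m v) 0 0.
  by rewrite mulmxA fB -scalemxAl mxE.
(* A nonpositive [l] would contradict [l Br >= i l], as [Br] has diagonal
   entries at least [1 > i]. *)
have l_pos j k : (forall h : 'I_2 -> R, h 0 + h 1 = h j + h k) ->
    l 0 j < 0 -> 0 < l 0 k.
  move=> jk lj; rewrite ltNge; apply/negP => lk.
  have := congr1 (fun g : 'rV_2 => g 0 j) lB.
  rewrite mulmx2E (jk (fun i => l 0 i * Br i j)).
  rewrite [RHS]mxE [X in _ = X + _]mxE [X in _ = _ + X]mxE.
  have h1 : l 0 j * Br j j <= l 0 j by rewrite ger_nMr.
  have h2 : l 0 k * Br k j <= 0 by rewrite mulr_le0_ge0 // ltW.
  have h3 : l 0 j < i * l 0 j by rewrite ltr_nMl.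
  have h4 : 0 <= (mu * (lam - i) - (z - x * i)) * f 0 j.
    by rewrite mulr_ge0 ?subr_ge0 // ltW.
  by move=> h5; move: h1; rewrite leNgt; lra.
pose M := map_mx toR (phi A B w).
have M_ge0 : nonneg M.
  by move=> ? ?; rewrite mxE ler0z nonneg_phi //; [apply: SA.1 | apply: SB.1].
have lam_ge0 := ltW lam_gt0.
have mu_ge0 : 0 <= mu by lra.
have detM : 0 < \det ((lam ^+ size w)%:M - M).
  apply: (@det_scalar_sub_gt0 _ f l) => //.
  - by apply: l_pos.
  - by apply: l_pos => g; rewrite addrC.
  - by move=> v /(cone_phi lam_ge0 mu_ge0 coneA coneB fAmu fBlam w) [].
  move=> v Cv fv.
  have [_] := cone_phi lam_ge0 mu_ge0 coneA coneB fAmu fBlam w Cv.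
  (* The inequality is strict because [mu < lam] and [w] contains at least one [false]. *)
  move=> /le_lt_trans -> //; rewrite ltr_pM2r // -(count_bool w) exprD.
  rewrite ltr_pM2r ?exprn_gt0 //.
  by rewrite ltrXn2r // -lt0n -has_count has_pred1.
have detN : \det ((lam ^+ size w)%:M - map_mx toR (phi A B (nseq (size w) true))) = 0.
  apply/eqP/det0P; exists f.
    by apply/eqP => f0; have := f_gt0 0; rewrite f0 mxE ltxx.
  by rewrite mulmxBr mul_mx_scalar (phi_nseq_true A _ fB) subrr.
(* Both products have determinant 1, so their characteristic polynomials at [lam ^+ size w] differ
   only in the trace term. *)
move: detM; rewrite -detN !det2_subscalar !det_map_mx !det_phi // ltrD2r ltrD2l.
rewrite ltrN2 ltr_pM2r ?exprn_gt0 //.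
by rewrite !trace_map_mx ltr_int.
Qed.

(** * From traces to optimal words *)

Lemma word_no_false (w : word) : false \notin w -> w = nseq (size w) true.
Proof. by elim: w => [|[] w IHw] //=; rewrite inE /= => /IHw <-. Qed.

Lemma lex_lt_irr w : lex_lt w w = false.
Proof. by elim: w => [|[] w IHw] //=. Qed.

Lemma wtr_wpow1 (A B : 'M[int]_2) w : wtr A B (wpow w 1) = wtr A B w.
Proof. by rewrite /wpow /= cats0. Qed.

Theorem theorem5p7 (R : realType) (A B : 'M[int]_2) :
  SL2Znn A -> SL2Znn B -> A *m B != B *m A ->
  well_oriented (map_mx (intr : int -> R) A) (map_mx (intr : int -> R) B) ->
  \tr A < \tr B -> \tr (A *m B) < \tr (B *m B) ->
  forall S : word -> Prop,
    complete_optimal A B S <-> (forall w, S w <-> w = [:: true]).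
Proof.
move=> SA SB _ _ trAB trABB S.
(* As [[:: true]] has length 1, the order compares [w] itself with the power of [b] of the same
   length. *)
have wle_b w : wle A B w [:: true].
  rewrite /wle /= wtr_wpow1 wpow_true.
  have [/(wtr_lt_power_true R SA SB trAB trABB)/ltW //|/word_no_false <-] :=
    boolP (false \in w).
  exact: lexx.
have maxb : maximal A B [:: true] by split.
have max_power w : maximal A B w -> w = nseq (size w) true.
  case=> _ /(_ [:: true] isT); rewrite /wle /= wtr_wpow1 wpow_true => le_bw.
  apply: word_no_false; apply/negP.
  by move=> /(wtr_lt_power_true R SA SB trAB trABB); rewrite ltNge le_bw.
have lynb : lyndon [:: true] by split=> // -[|[|k]].
split=> [[S_opt S_all] | SE]; last first.
  split=> [w /SE -> // | w /max_power w_eq].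
  exists [:: true], 0%N, (size w); split; first exact/SE.
  by rewrite rot0 wpow_true.
(* A power of [b] of length at least 2 equals its rotation by one letter, so it is not Lyndon. *)
have S_true w : S w -> w = [:: true].
  move=> /S_opt[[w_gt0 lyn] /max_power w_eq].
  move: w_gt0 lyn; rewrite w_eq size_nseq; case: (size w) => [|[|n]] // _.
  by move=> /(_ 1%N isT); rewrite rot1_cons -cats1 -(nseqD n.+1 1) addn1 lex_lt_irr.
move=> w; split=> [/S_true // | ->].
(* Completeness applied to the maximal word [b] shows that [S] is inhabited. *)
have [u [k [n [Su _]]]] := S_all _ maxb.
by rewrite -(S_true _ Su).
Qed.
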